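(* The Hilbert series of the coordinate ring of the cone of ${\mathrm{SO}}(4)$ is \[\mathrm{H}(\mathcal{O}(\mathcal{C}({\mathrm{SO}}(4)));t)=\frac{1+9t+9t^2+t^3}{(1-t)^7}.\]
   Context: ${\mathrm{SO}}(4)=\{M\in\mathbb{C}^{4\times4}\mid M^TM=I,\ \det M=1\}$. The cone $\mathcal{C}({\mathrm{SO}}(4))$ is the Zariski closure in $\mathbb{C}^{4\times 4}$ of $\{cM\mid c\in\mathbb{C},M\in{\mathrm{SO}}(4)\}$; its coordinate ring is the quotient of the standard graded polynomial ring $\mathbb{C}[x_{ij}\mid1\le i,j\le4]$ by the homogeneous vanishing ideal, with the induced grading. The Hilbert series of a graded algebra $A=\bigoplus_dA_d$ is $\sum_d\dim_{\mathbb{C}}(A_d)t^d$. *)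

(* Defs.v *)
From HB Require Import structures.
From mathcomp Require Import all_boot all_order all_algebra.
From mathcomp Require Import mpoly.
From mathcomp Require Import complex.
From mathcomp Require Import Rstruct.

Set Implicit Arguments.
Unset Strict Implicit.
Unset Printing Implicit Defensive.

Import Order.TTheory GRing.Theory Num.Theory.
Local Open Scope ring_scope.

Notation CC := ((Rdefinitions.R)[i] : numClosedFieldType) (only parsing).

(* The polynomial ring C[x_ij | 1 <= i,j <= 4]: 16 variables, the variable
   x_ij being 'X_(mxvec_index i j), i.e. indexed like the entries of mxvec M. *)
Definition Pol := {mpoly CC[4 * 4]}.

Definition evalM (p : Pol) (M : 'M[CC]_4) : CC :=
  p.@[fun k : 'I_(4 * 4) => mxvec M 0 k].

Definition SO4 (M : 'M[CC]_4) : Prop := M^T *m M = 1%:M /\ \det M = 1.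

Definition scaledSO4 (N : 'M[CC]_4) : Prop :=
  exists (c : CC) (M : 'M[CC]_4), SO4 M /\ N = c *: M.

Definition vanishing (S : 'M[CC]_4 -> Prop) (p : Pol) : Prop :=
  forall N, S N -> evalM p N = 0.
Definition zariski_closure (S : 'M[CC]_4 -> Prop) (N : 'M[CC]_4) : Prop :=
  forall p, vanishing S p -> evalM p N = 0.

Definition coneSO4 := zariski_closure scaledSO4.
Definition I_cone (p : Pol) : Prop := vanishing coneSO4 p.

(* The degree-d component A_d of A = C[x_ij]/I (standard grading) has
   C-dimension n: there are n homogeneous degree-d polynomials whose classes
   in A are linearly independent, and any n+1 classes of homogeneous degree-d
   polynomials are linearly dependent. *)
Definition lin_indep_mod_I (d n : nat) (f : 'I_n -> Pol) : Prop :=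
  (forall i, f i \is d.-homog) /\
  (forall c : 'I_n -> CC, I_cone (\sum_(i < n) c i *: f i) -> forall i, c i = 0).

Definition dim_graded_piece (d n : nat) : Prop :=
  (exists f : 'I_n -> Pol, lin_indep_mod_I d f) /\
  (forall f : 'I_n.+1 -> Pol, ~ lin_indep_mod_I d f).

Definition numer (d : nat) : int :=
  match d with 0 => 1 | 1 => 9 | 2 => 9 | 3 => 1 | _ => 0 end.

(* H(t) = N(t)/(1-t)^7 as formal power series, i.e. (1-t)^7 H(t) = N(t):
   coefficientwise, sum_{j=0}^{min(d,7)} (-1)^j C(7,j) h(d-j) = N_d. *)
Definition hilbert_series_is (h : nat -> nat) : Prop :=
  forall d : nat,
    \sum_(j < 8 | (j <= d)%N) (-1) ^+ j * ('C(7, j))%:R * ((h (d - j)%N)%:R : int)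
    = numer d.

(* Main.v *)
Require Import Defs.
From mathcomp Require Import all_boot all_order all_algebra.
From mathcomp Require Import mpoly.
From mathcomp Require Import complex Rstruct ring.

(** Identify C^4 with the complex quaternions.  The elements of SO(4) are the
    maps x |-> p x q^* with N(p) N(q) = 1: after composing with a multiplication
    one may assume that 1 is fixed, and then orthogonality and the equality of a
    rotation with its cofactor matrix say that its matrix of coordinates on the
    maps x |-> e_a x e_b^* has rank one.  So a form vanishes on the cone iff it
    vanishes on all matrices L(p) R(q).  The 16 products p_a q_b are, up to an
    invertible linear change of coordinates, the entries of L(p) R(q): the cone
    is the affine cone over the Segre variety P^3 x P^3.  Hence the forms of
    degree d modulo the ideal are the polynomials in (p, q) of bidegree (d, d),
    and the Hilbert function is binomial(d + 3, 3)^2. *)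

Set Implicit Arguments.
Unset Strict Implicit.
Unset Printing Implicit Defensive.

Import Order.TTheory GRing.Theory Num.Theory.
Local Open Scope ring_scope.

Local Notation i0 := (@Ordinal 4 0 isT).
Local Notation i1 := (@Ordinal 4 1 isT).
Local Notation i2 := (@Ordinal 4 2 isT).
Local Notation i3 := (@Ordinal 4 3 isT).

(** * Quaternion multiplication as matrices *)

Definition mx4 (V : nmodType) (s : seq (seq V)) : 'M[V]_4 :=
  \matrix_(i, j) nth 0 (nth [::] s i) j.

(** * Determinants of explicit matrices *)

Section Matrices.
Variable R : comPzRingType.
Implicit Types f : nat -> nat -> R.

Lemma sum4 (F : 'I_4 -> R) : \sum_i F i =
  F i0 + F i1 + F i2 + F i3.
Proof.
do 4 rewrite big_ord_recr /=; rewrite big_ord0 add0r.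
by congr (F _ + F _ + F _ + F _); apply: val_inj.
Qed.

Lemma cofactor_matrix n f (i j : 'I_n.+1) :
  cofactor (\matrix_(k, l) f k l) i j =
  (-1) ^+ (i + j) * \det (\matrix_(k < n, l < n) f (bump i k) (bump j l)).
Proof. by congr (_ * \det _); apply/matrixP=> k l; rewrite !mxE. Qed.

(** Entries are indexed by natural numbers, so a minor is again given by such a function; on
    explicit entries the recursion unfolds to an expression that [ring] can treat. *)
Fixpoint laplace n f : R :=
  if n is n'.+1 then
    \sum_(j < n) f 0%N j *
      ((-1) ^+ j * laplace n' (fun k l => f k.+1 (bump j l)))
  else 1.

Lemma det_laplace n f : \det (\matrix_(i < n, j < n) f i j) = laplace n f.
Proof.
elim: n f => [|n IHn] f; first by rewrite det_mx00.
rewrite (expand_det_row _ ord0); apply: eq_bigr => j _.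
rewrite mxE cofactor_matrix.
by congr (_ * (_ * _)); apply: (IHn (fun k l => f k.+1 (bump j l))).
Qed.

End Matrices.

Lemma ord4_ind (P : 'I_4 -> Prop) :
  P i0 -> P i1 -> P i2 -> P i3 -> forall i, P i.
Proof.
move=> P0 P1 P2 P3 [[|[|[|[|//]]]] lti].
- by rewrite (_ : Ordinal lti = i0) //; apply: val_inj.
- by rewrite (_ : Ordinal lti = i1) //; apply: val_inj.
- by rewrite (_ : Ordinal lti = i2) //; apply: val_inj.
- by rewrite (_ : Ordinal lti = i3) //; apply: val_inj.
Qed.

(* [lquat p *m rquat q] depends linearly on the products [p a * q b], and in
   this basis the linear map is an involution up to the factor 4. *)
Definition qtransform (R : comPzRingType) (A : 'M[R]_4) : 'M[R]_4 :=
  mx4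
  [:: [:: A i0 i0 + A i1 i1 + A i2 i2 + A i3 i3;
          A i0 i1 + A i3 i2 - A i1 i0 - A i2 i3;
          A i0 i2 + A i1 i3 - A i2 i0 - A i3 i1;
          A i0 i3 + A i2 i1 - A i1 i2 - A i3 i0];
      [:: A i1 i0 + A i3 i2 - A i0 i1 - A i2 i3;
          A i0 i0 + A i1 i1 - A i2 i2 - A i3 i3;
          A i1 i2 + A i2 i1 - A i0 i3 - A i3 i0;
          A i0 i2 + A i1 i3 + A i2 i0 + A i3 i1];
      [:: A i1 i3 + A i2 i0 - A i0 i2 - A i3 i1;
          A i0 i3 + A i1 i2 + A i2 i1 + A i3 i0;
          A i0 i0 + A i2 i2 - A i1 i1 - A i3 i3;
          A i2 i3 + A i3 i2 - A i0 i1 - A i1 i0];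
      [:: A i2 i1 + A i3 i0 - A i0 i3 - A i1 i2;
          A i1 i3 + A i3 i1 - A i0 i2 - A i2 i0;
          A i0 i1 + A i1 i0 + A i2 i3 + A i3 i2;
          A i0 i0 + A i3 i3 - A i1 i1 - A i2 i2]].

Section Quaternions.
Variable R : comPzRingType.
Implicit Types p q : 'I_4 -> R.

(* Matrices of x |-> p x and of x |-> x q^*, with q^* the conjugate of q, on the
   quaternions with basis 1, i, j, k. *)
Definition lquat p : 'M[R]_4 := mx4
  [:: [:: p i0; - p i1; - p i2; - p i3];
      [:: p i1;   p i0; - p i3;   p i2];
      [:: p i2;   p i3;   p i0; - p i1];
      [:: p i3; - p i2;   p i1;   p i0]].

Definition rquat q : 'M[R]_4 := mx4
  [:: [::   q i0;   q i1;   q i2;   q i3];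
      [:: - q i1;   q i0; - q i3;   q i2];
      [:: - q i2;   q i3;   q i0; - q i1];
      [:: - q i3; - q i2;   q i1;   q i0]].

Definition qnorm p := p i0 ^+ 2 + p i1 ^+ 2 + p i2 ^+ 2 + p i3 ^+ 2.

Lemma lquat_orth p : (lquat p)^T *m lquat p = (qnorm p)%:M.
Proof.
apply/matrixP; elim/ord4_ind; elim/ord4_ind;
  rewrite !mxE sum4 !mxE /qnorm /=; ring.
Qed.

Lemma rquat_orth p : (rquat p)^T *m rquat p = (qnorm p)%:M.
Proof.
apply/matrixP; elim/ord4_ind; elim/ord4_ind;
  rewrite !mxE sum4 !mxE /qnorm /=; ring.
Qed.

Lemma det_lquat p : \det (lquat p) = qnorm p ^+ 2.
Proof.
rewrite (det_laplace 4 (fun i j => nth 0 (nth [::] _ i) j)) /=.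
by rewrite !big_ord_recr !big_ord0 /= /bump /= /qnorm; ring.
Qed.

Lemma det_rquat p : \det (rquat p) = qnorm p ^+ 2.
Proof.
rewrite (det_laplace 4 (fun i j => nth 0 (nth [::] _ i) j)) /=.
by rewrite !big_ord_recr !big_ord0 /= /bump /= /qnorm; ring.
Qed.

(** Associativity of the quaternions: x |-> p (q x) is left multiplication by p q, and p q is the
    image of 1, that is, the first column. *)
Lemma lquat_mul p q :
  lquat p *m lquat q = lquat (fun i => (lquat p *m lquat q) i ord0).
Proof.
have ->: ord0 = i0 by apply: val_inj.
apply/matrixP; elim/ord4_ind; elim/ord4_ind;
  rewrite !mxE sum4 !mxE /= ?sum4 ?mxE /=; ring.
Qed.

Lemma lrquatE p q :
  lquat p *m rquat q = qtransform (\matrix_(a, b) (p a * q b)).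
Proof.
apply/matrixP; elim/ord4_ind; elim/ord4_ind;
  rewrite !mxE sum4 !mxE /=; ring.
Qed.

End Quaternions.

Lemma qtransformK (R : comPzRingType) (A : 'M[R]_4) :
  qtransform (qtransform A) = A *+ 4.
Proof.
apply/matrixP; elim/ord4_ind; elim/ord4_ind;
  rewrite mxE mulmxnE /= !mxE /=; ring.
Qed.

(** * SO(4) and pairs of quaternions *)

(** Reduces x = y to a known relation u = v, leaving x - y = u - v to [ring]; [eqrD] and [eqrB]
    assemble u = v from several relations. *)
Lemma eq_of_sub (V : zmodType) (x y u v : V) : u = v -> x - y = u - v -> x = y.
Proof. by move=> -> /eqP; rewrite subrr subr_eq0 => /eqP. Qed.

Lemma eqrD (V : zmodType) (x y u v : V) : x = y -> u = v -> x + u = y + v.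
Proof. by move=> -> ->. Qed.

Lemma eqrB (V : zmodType) (x y u v : V) : x = y -> u = v -> x - u = y - v.
Proof. by move=> -> ->. Qed.

Lemma cofactor_mx4 (R : comPzRingType) (s : seq (seq R)) i j :
  cofactor (mx4 s) i j = (-1) ^+ (i + j) *
    laplace 3 (fun k l => nth 0 (nth [::] s (bump i k)) (bump j l)).
Proof.
by rewrite (cofactor_matrix (fun i j => nth 0 (nth [::] s i) j))
  (det_laplace 3 (fun k l => nth 0 (nth [::] s (bump i k)) (bump j l))).
Qed.

Local Ltac by_rel E :=
  first [ apply: (eq_of_sub E); ring | apply: (eq_of_sub (esym E)); ring ].

Local Ltac by_cof E := have := E;
  rewrite cofactor_mx4 !mxE /= !big_ord_recr !big_ord0 /= /bump /= => <-; ring.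

Section Rotations.
Variable F : numFieldType.
Implicit Types (p q : 'I_4 -> F) (M : 'M[F]_4).

(** If the 2x2 minors through a nonzero pivot vanish, Z is a column times a row, hence a matrix of
    products p_c q_d; undoing [qtransform] recovers M. *)
Lemma minors0_lrquat M a b (Z := qtransform M) :
    Z a b != 0 -> (forall c d, Z a b * Z c d = Z c b * Z a d) ->
  exists p q, M = lquat p *m rquat q.
Proof.
have := qtransformK M; rewrite -/Z => ZK; clearbody Z => Zab0 minor0.
(* The pivot column, normalized at the pivot, and the pivot row; the 4 cancels the factor in
   [qtransformK]. *)
exists (fun c => Z c b / Z a b), (fun d => Z a d / 4).
rewrite lrquatE; have -> : (\matrix_(c, d) (Z c b / Z a b * (Z a d / 4))) =
  4^-1 *: Z.
  apply/matrixP=> c d; rewrite !mxE; apply: (mulfI Zab0).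
  by rewrite [RHS]mulrCA minor0; field.
have -> : qtransform (4^-1 *: Z) = 4^-1 *: qtransform Z.
  by apply/matrixP; elim/ord4_ind; elim/ord4_ind; rewrite !mxE /=; ring.
by rewrite ZK -scaler_nat scalerA mulVf ?scale1r ?pnatr_eq0.
Qed.

Lemma rotation_lrquat (a b c d e f g h k : F)
    (M := mx4 [:: [:: 1; 0; 0; 0]; [:: 0; a; b; c];
                  [:: 0; d; e; f]; [:: 0; g; h; k]]) :
    M^T *m M = 1%:M -> \det M = 1 ->
  exists p q, M = lquat p *m rquat q.
Proof.
move=> MtM detM; have MMt : M *m M^T = 1%:M by apply: mulmx1C.
have row i j : M i i0 * M j i0 + M i i1 * M j i1 + M i i2 * M j i2
    + M i i3 * M j i3 = (i == j)%:R.
  have <- : (M *m M^T) i j = (i == j)%:R by rewrite MMt mxE.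
  by rewrite [(_ *m _) _ _]mxE sum4 ![M^T _ _]mxE.
have col i j : M i0 i * M i0 j + M i1 i * M i1 j + M i2 i * M i2 j
    + M i3 i * M i3 j = (i == j)%:R.
  have <- : (M^T *m M) i j = (i == j)%:R by rewrite MtM mxE.
  by rewrite [(_ *m _) _ _]mxE sum4 ![M^T _ _]mxE.
(* Since M has determinant 1, its adjugate is its inverse, which is its transpose. *)
have cof i j : cofactor M i j = M i j.
  have <-: (\adj M)^T i j = cofactor M i j by rewrite !mxE.
  by rewrite -[\adj M]mul1mx -MtM -mulmxA mul_mx_adj detM mulmx1 trmxK.
have r1 := row i1 i1; have r2 := row i2 i2; have r3 := row i3 i3.
have r12 := row i1 i2; have r13 := row i1 i3; have r23 := row i2 i3.
have c1 := col i1 i1; have c2 := col i2 i2; have c3 := col i3 i3.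
have c12 := col i1 i2; have c13 := col i1 i3; have c23 := col i2 i3.
rewrite !mxE /= in r1 r2 r3 r12 r13 r23 c1 c2 c3 c12 c13 c23.
have m1 : e * k - f * h = a by by_cof (cof i1 i1).
have m2 : a * k - c * g = e by by_cof (cof i2 i2).
have m3 : a * e - b * d = k by by_cof (cof i3 i3).
have m12 : f * g - d * k = b by by_cof (cof i1 i2).
have m13 : d * h - e * g = c by by_cof (cof i1 i3).
have m23 : b * g - a * h = f by by_cof (cof i2 i3).
have m21 : c * h - b * k = d by by_cof (cof i2 i1).
have m31 : b * f - c * e = g by by_cof (cof i3 i1).
have m32 : c * d - a * f = h by by_cof (cof i3 i2).
have ZE : qtransform M = mx4
  [:: [:: 1 + a + e + k; h - f; c - g; d - b];
      [:: h - f; 1 + a - e - k; b + d; c + g];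
      [:: c - g; b + d; 1 + e - a - k; f + h];
      [:: d - b; c + g; f + h; 1 + k - a - e]].
  by congr mx4; rewrite !mxE /=; do !congr (_ :: _); ring.
(* The trace of [qtransform M] is 4, so some diagonal entry can serve as pivot. *)
have [i Zii0] : exists i, qtransform M i i != 0.
  apply/existsP; apply: contraT; rewrite negb_exists => /forallP Z0.
  have /eqP[] : 4 != 0 :> F by rewrite pnatr_eq0.
  transitivity (\sum_i qtransform M i i).
    by rewrite ZE sum4 !mxE /=; ring.
  by apply: big1 => i _; apply/eqP; have := Z0 i; rewrite negbK.
apply: (minors0_lrquat Zii0) => r s; rewrite ZE.
(* Up to sign, each 2x2 minor of [qtransform M] that contains a diagonal entry
   is one of the following combinations of the orthogonality relations between
   rows ([r_]) or columns ([c_]) and the cofactor relations ([m_]). *)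
elim/ord4_ind: i {Zii0}; elim/ord4_ind: r; elim/ord4_ind: s; rewrite !mxE /=;
  first [ exact: mulrC | reflexivity
    | by_rel (eqrB c1 (eqrD r2 (eqrD r3 (eqrD m1 m1))))
    | by_rel (eqrB (eqrD c1 (eqrD m1 m1)) (eqrD r2 r3))
    | by_rel (eqrB c2 (eqrD r1 (eqrD r3 (eqrD m2 m2))))
    | by_rel (eqrB (eqrD c2 (eqrD m2 m2)) (eqrD r1 r3))
    | by_rel (eqrB c3 (eqrD r1 (eqrD r2 (eqrD m3 m3))))
    | by_rel (eqrB (eqrD c3 (eqrD m3 m3)) (eqrD r1 r2))
    | by_rel (eqrD (eqrD r12 c12) (eqrD m12 m21))
    | by_rel (eqrB (eqrD r12 c12) (eqrD m12 m21))
    | by_rel (eqrD (eqrB r12 c12) (eqrB m12 m21))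
    | by_rel (eqrB (eqrB r12 c12) (eqrB m12 m21))
    | by_rel (eqrD (eqrD r13 c13) (eqrD m13 m31))
    | by_rel (eqrB (eqrD r13 c13) (eqrD m13 m31))
    | by_rel (eqrD (eqrB r13 c13) (eqrB m13 m31))
    | by_rel (eqrB (eqrB r13 c13) (eqrB m13 m31))
    | by_rel (eqrD (eqrD r23 c23) (eqrD m23 m32))
    | by_rel (eqrB (eqrD r23 c23) (eqrD m23 m32))
    | by_rel (eqrD (eqrB r23 c23) (eqrB m23 m32))
    | by_rel (eqrB (eqrB r23 c23) (eqrB m23 m32)) ].
Qed.

(** The image v of 1 under M has norm 1. Undoing left multiplication by v leaves a rotation that
    fixes 1, and left multiplications compose. *)
Lemma SO4_lrquat M : M^T *m M = 1%:M -> \det M = 1 ->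
  exists p q, M = lquat p *m rquat q.
Proof.
move=> MtM detM; pose v i := M i i0.
have Nv : qnorm v = 1.
  have : (M^T *m M) i0 i0 = 1 by rewrite MtM mxE.
  by rewrite mxE sum4 !mxE /qnorm !expr2.
have LtL : (lquat v)^T *m lquat v = 1%:M by rewrite lquat_orth Nv.
have LLt : lquat v *m (lquat v)^T = 1%:M by apply: mulmx1C.
pose N := (lquat v)^T *m M.
have NtN : N^T *m N = 1%:M.
  by rewrite trmx_mul trmxK -mulmxA (mulmxA (lquat v)) LLt mul1mx.
have detN : \det N = 1.
  by rewrite det_mulmx det_tr det_lquat Nv detM expr1n mulr1.
have Ncol i : N i i0 = (i == i0)%:R.
  transitivity (((lquat v)^T *m lquat v) i i0); last by rewrite LtL mxE.
  by rewrite !mxE; apply: eq_bigr; elim/ord4_ind => _; rewrite !mxE /=.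
(* The other columns of N are orthogonal to the first one, which is the unit vector 1. *)
have Nrow j : N i0 j = (i0 == j)%:R.
  transitivity ((N^T *m N) i0 j); last by rewrite NtN mxE.
  by rewrite [(_ *m _) _ _]mxE sum4 ![N^T _ _]mxE !Ncol /=; ring.
have : exists p q, N = lquat p *m rquat q.
  suff NE : N = mx4 [:: [:: 1; 0; 0; 0];
      [:: 0; N i1 i1; N i1 i2; N i1 i3];
      [:: 0; N i2 i1; N i2 i2; N i2 i3];
      [:: 0; N i3 i1; N i3 i2; N i3 i3]].
    by rewrite NE; apply: rotation_lrquat; rewrite -NE.
  by apply/matrixP; elim/ord4_ind; elim/ord4_ind; rewrite [RHS]mxE ?Ncol ?Nrow.
case=> p [q NE]; exists (fun i => (lquat v *m lquat p) i ord0), q.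
by rewrite -lquat_mul -mulmxA -NE mulmxA LLt mul1mx.
Qed.

End Rotations.

(** * Polynomial functions of two vectors *)

(** A nonzero p has fewer than [size p] roots, while the naturals below [size p] are that many
    distinct ones. *)
Lemma poly_vanish (K : numDomainType) (p : {poly K}) :
  (forall x, p.[x] = 0) -> p = 0.
Proof.
move=> p0; apply: (@roots_geq_poly_eq0 _ _ [seq i%:R | i <- iota 0 (size p)]).
- by apply/allP=> x _; apply/eqP/p0.
- by rewrite map_inj_uniq ?iota_uniq // => i j /eqP; rewrite eqr_nat => /eqP.
- by rewrite size_map size_iota.
Qed.

(** Induction on the number of variables. With the other variables fixed at w, p is a univariate
    polynomial in the last one; it vanishes everywhere, so its coefficients vanish at every w. *)
Lemma mpoly_vanish (K : numDomainType) n (p : {mpoly K[n]}) :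
  (forall v, p.@[v] = 0) -> p = 0.
Proof.
elim: n p => [|n IHn] p p0.
  apply/mpolyP=> m; rewrite mcoeff0; have := p0 (fun=> 0).
  have m0 (m' : 'X_{1..0}) : m' = m by apply/mnmP; case.
  rewrite mevalE; case: (boolP (m \in msupp p)) => [mp|/memN_msupp_eq0 //].
  rewrite (bigD1_seq m) ?msupp_uniq //= big_ord0 mulr1 big1 ?addr0 //.
  by move=> m' /eqP; rewrite (m0 m').
(* [P k] is the coefficient of the k-th power of the last variable. *)
pose P k := (\sum_(m <- msupp p | m ord_max == k)
  p@_m *: 'X_[[multinom m (widen_ord (leqnSn n) i) | i < n]] : {mpoly K[n]}).
pose d := msize p.
have lt_d m : m \in msupp p -> (m ord_max < d)%N.
  by move=> mp; apply: leq_ltn_trans (msize_mdeg_lt mp); rewrite mdegE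
    (bigD1 ord_max) //= leq_addr.
have P0 k : P k = 0.
  apply: IHn => w; have : \poly_(l < d) (P l).@[w] = 0.
    apply: poly_vanish => t; rewrite horner_poly.
    pose v i := if unlift ord_max i is Some j then w j else t.
    rewrite -[RHS](p0 v) mevalE.
    transitivity (\sum_(l < d) \sum_(m <- msupp p | m ord_max == l)
        p@_m * \prod_i v i ^+ m i).
      apply: eq_bigr => l _; rewrite raddf_sum mulr_suml; apply: eq_bigr => m.
      move/eqP=> <-; rewrite /= mevalZ mevalX big_ord_recr /= /v unlift_none.
      rewrite mulrA.
      congr (_ * _ * _); apply: eq_bigr => i _; rewrite mnmE.
      have -> : widen_ord (leqnSn n) i = lift ord_max i.
        by apply: val_inj; rewrite /= /bump leqNgt ltn_ord.
      by rewrite liftK.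
    rewrite (exchange_big_dep predT) //= big_seq [RHS]big_seq.
    apply: eq_bigr => m /lt_d ltm; exact: (big_pred1 (Ordinal ltm)).
  move=> /polyP/(_ k); rewrite coef_poly coef0; case: ltnP => // led _.
  rewrite /P big_seq_cond big_pred0 ?meval0 // => m; apply/negP.
  by case/andP=> /lt_d ltm /eqP mk; rewrite mk ltnNge led in ltm.
apply/mpolyP=> m; rewrite mcoeff0.
case: (boolP (m \in msupp p)) => [mp|/memN_msupp_eq0 //].
(* A monomial is determined by its last exponent and the remaining ones, so this coefficient of
   [P (m ord_max)] is just [p@_m]. *)
have := congr1 (mcoeff [multinom m (widen_ord (leqnSn n) i) | i < n])
  (P0 (m ord_max)).
rewrite mcoeff0 /P raddf_sum /= big_mkcond (bigD1_seq m) ?msupp_uniq //= eqxx.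
rewrite mcoeffZ mcoeffX eqxx mulr1 big1 ?addr0 // => m' m'm.
case: eqP => // e; rewrite mcoeffZ mcoeffX.
case: eqP => [em|]; last by rewrite mulr0.
case/eqP: m'm; apply/mnmP=> i; case: (unliftP ord_max i) => [j|] -> //.
have := congr1 (fun u : 'X_{1..n} => u j) em; rewrite !mnmE.
have -> // : widen_ord (leqnSn n) j = lift ord_max j.
by apply: val_inj; rewrite /= /bump leqNgt ltn_ord.
Qed.

Lemma monomial_basis n d : exists2 b : 'I_('C(d + n, d)) -> 'X_{1..n.+1},
  injective b & forall m, (mdeg m = d) <-> exists i, m = b i.
Proof.
pose s := [seq s2m t | t : d.-tuple 'I_n.+1 <- enum (basis n.+1 d)].
have sz : size s = 'C(d + n, d) by apply: size_basis.
exists (fun i => nth 0%MM s i) => [i j /eqP|m].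
  by rewrite nth_uniq ?sz ?uniq_basis // => /eqP/val_inj.
split=> [/eqP|[i ->]].
  rewrite basis_cover => /nthP ms.
  case: (ms 0%MM) => i; rewrite -/s sz => lti <-.
  by exists (Ordinal lti).
by apply/eqP; rewrite basis_cover mem_nth // -/s sz.
Qed.

(** * Functions of bidegree (d, d) *)

Section Bihomogeneous.
Variables (F : comNzRingType) (n : nat).
Implicit Types (G : ('I_n.+1 -> F) -> ('I_n.+1 -> F) -> F) (d e : nat).

(** Written as a finite sum of products, so that the two groups of variables stay in separate
    polynomial rings. *)
Definition bihomog d G : Prop :=
  exists s : seq ({mpoly F[n.+1]} * {mpoly F[n.+1]}),
    (forall A, A \in s -> A.1 \is d.-homog /\ A.2 \is d.-homog) /\
    forall p q, G p q = \sum_(A <- s) A.1.@[p] * A.2.@[q].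

Lemma bihomog0 d : bihomog d (fun _ _ => 0).
Proof. by exists [::]; split=> // p q; rewrite big_nil. Qed.

Lemma bihomog1 : bihomog 0 (fun _ _ => 1).
Proof.
exists [:: (1, 1)]; split=> [A|p q]; last by rewrite big_seq1 !meval1 mulr1.
by rewrite inE => /eqP ->; split; apply: dhomog1.
Qed.

Lemma bihomogD d G H : bihomog d G -> bihomog d H ->
  bihomog d (fun p q => G p q + H p q).
Proof.
move=> [s [hs Gs]] [t [ht Ht]]; exists (s ++ t); split=> [A|p q].
  by rewrite mem_cat => /orP[/hs|/ht].
by rewrite big_cat Gs Ht.
Qed.

Lemma bihomogM d e G H : bihomog d G -> bihomog e H ->
  bihomog (d + e) (fun p q => G p q * H p q).
Proof.
move=> [s [hs Gs]] [t [ht Ht]].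
exists [seq (A.1 * B.1, A.2 * B.2) | A <- s, B <- t]; split=> [Q|p q].
  case/allpairsP=> -[A B] /= [As Bt ->].
  have {As} [A1 A2] := hs _ As; have {Bt} [B1 B2] := ht _ Bt.
  by split; apply: dhomogM.
rewrite big_allpairs_dep Gs Ht mulr_suml; apply: eq_bigr => A _.
by rewrite mulr_sumr; apply: eq_bigr => B _; rewrite !mevalM mulrACA.
Qed.

Lemma bihomogZ d c G : bihomog d G -> bihomog d (fun p q => c * G p q).
Proof.
move=> [s [hs Gs]]; exists [seq (c *: A.1, A.2) | A <- s]; split=> [Q|p q].
  by case/mapP=> A As ->; case: (hs _ As) => A1 A2; split=> //; apply: rpredZ.
by rewrite Gs mulr_sumr big_map; apply: eq_bigr => A _; rewrite mevalZ mulrA.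
Qed.

Lemma bihomog_sum (I : eqType) (r : seq I) d
    (G : I -> ('I_n.+1 -> F) -> ('I_n.+1 -> F) -> F) :
  (forall i, i \in r -> bihomog d (G i)) ->
  bihomog d (fun p q => \sum_(i <- r) G i p q).
Proof.
elim: r => [|i r IHr] hG.
  by case: (bihomog0 d) => s [hs Gs]; exists s; split=> // p q; rewrite big_nil.
have [||s [hs Gs]] := @bihomogD d (G i) (fun p q => \sum_(i <- r) G i p q).
- by apply: hG; rewrite mem_head.
- by apply: IHr => j jr; apply: hG; rewrite in_cons jr orbT.
by exists s; split=> // p q; rewrite big_cons.
Qed.

Lemma bihomog_prod (I : Type) (r : seq I) (d : I -> nat)
    (G : I -> ('I_n.+1 -> F) -> ('I_n.+1 -> F) -> F) :
  (forall i, bihomog 1 (G i)) ->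
  bihomog (\sum_(i <- r) d i) (fun p q => \prod_(i <- r) G i p q ^+ d i).
Proof.
move=> hG; elim: r => [|i r IHr].
  rewrite big_nil; case: bihomog1 => s [hs Gs].
  by exists s; split=> // p q; rewrite big_nil.
have hX k : bihomog k (fun p q => G i p q ^+ k).
  elim: k => [|k IHk]; first exact: bihomog1.
  case: (bihomogM (hG i) IHk) => s [hs Gs].
  by exists s; split=> // p q; rewrite exprS.
case: (bihomogM (hX (d i)) IHr) => s [hs Gs].
by exists s; rewrite big_cons; split=> // p q; rewrite big_cons.
Qed.

(** Both factors of each product are expanded in monomials. This spanning property gives the upper
    bound on the dimension. *)
Lemma bihomog_coef d G N (b : 'I_N -> 'X_{1..n.+1}) : injective b ->
    (forall m, (mdeg m = d) <-> exists i, m = b i) -> bihomog d G ->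
  exists C : 'M[F]_N, forall p q,
    G p q = \sum_i \sum_j C i j * ('X_[b i].@[p] * 'X_[b j].@[q]).
Proof.
move=> b_inj b_cover [s [hs Gs]].
have homogE (A : {mpoly F[n.+1]}) : A \is d.-homog ->
    A = \sum_i A@_(b i) *: 'X_[b i].
  move=> hA; apply/mpolyP=> m; rewrite raddf_sum /=.
  have [md|md] := eqVneq (mdeg m) d.
    have [i ->] := (b_cover m).1 md.
    rewrite (bigD1 i) //= mcoeffZ mcoeffX eqxx mulr1 big1 ?addr0 // => j ji.
    by rewrite mcoeffZ mcoeffX (inj_eq b_inj) (negbTE ji) mulr0.
  rewrite (dhomog_nemf_coeff hA md) big1 // => i _.
  rewrite mcoeffZ mcoeffX; case: eqP => [bm|]; last by rewrite mulr0.
  by case/eqP: md; apply/b_cover; exists i.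
exists (\matrix_(i, j) \sum_(A <- s) A.1@_(b i) * A.2@_(b j)) => p q.
rewrite Gs; transitivity (\sum_(A <- s) \sum_i \sum_j
    A.1@_(b i) * A.2@_(b j) * ('X_[b i].@[p] * 'X_[b j].@[q])).
  apply: eq_big_seq => A As; case: (hs _ As) => /homogE{1}-> /homogE{1}->.
  rewrite !raddf_sum mulr_suml; apply: eq_bigr => i _; rewrite mulr_sumr.
  by apply: eq_bigr => j _; rewrite /= !mevalZ mulrACA.
rewrite exchange_big; apply: eq_bigr => i _; rewrite exchange_big /=.
by apply: eq_bigr => j _; rewrite mxE [RHS]mulr_suml.
Qed.

End Bihomogeneous.

(** * Independence of monomials on pairs of nonzero norm *)

Section QuaternionNorm.
Variable F : numFieldType.
Implicit Types p q : 'I_4 -> F.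

(** P times the norm polynomial vanishes everywhere, hence is zero; the norm polynomial is not, as
    it takes the value 1 at the quaternion 1. *)
Lemma mpoly_vanish_qnorm (P : {mpoly F[4]}) :
  (forall p, qnorm p != 0 -> P.@[p] = 0) -> P = 0.
Proof.
move=> P0; pose X i := 'X_i : {mpoly F[4]}.
have NE p : (qnorm X).@[p] = qnorm p.
  by rewrite /qnorm /X !mevalD !rmorphXn /= !mevalXU.
have N0 : qnorm X != 0.
  apply/eqP=> /(congr1 (meval (fun i => (i == i0)%:R))); rewrite NE meval0.
  by rewrite /qnorm /= !expr2 !mulr0 !addr0 mulr1 => /eqP; rewrite oner_eq0.
have /eqP : P * qnorm X = 0.
  apply: mpoly_vanish => p; rewrite mevalM NE.
  by have [->|/P0->] := eqVneq (qnorm p) 0; rewrite ?mulr0 ?mul0r.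
by rewrite mulf_eq0 (negbTE N0) orbF => /eqP.
Qed.

(** For fixed q the sum is a polynomial in p, so its coefficients vanish; these are polynomials in
    q, so theirs vanish too. This independence gives the lower bound on the dimension. *)
Lemma bihomog_coef_eq0 N (b : 'I_N -> 'X_{1..4}) (C : 'M[F]_N) :
    injective b -> (forall p q, qnorm p * qnorm q != 0 ->
    \sum_i \sum_j C i j * ('X_[b i].@[p] * 'X_[b j].@[q]) = 0) -> C = 0.
Proof.
move=> b_inj C0.
have coefX (c : 'I_N -> F) : \sum_i c i *: 'X_[b i] = 0 -> forall i, c i = 0.
  move=> c0 i; have /(congr1 (mcoeff (b i))) := c0.
  rewrite mcoeff0 raddf_sum /= (bigD1 i) //= mcoeffZ mcoeffX eqxx mulr1.
  rewrite big1 ?addr0 // => j ji.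
  by rewrite mcoeffZ mcoeffX (inj_eq b_inj) (negbTE ji) mulr0.
apply/matrixP=> i j; rewrite mxE; move: j; apply: (coefX (C i)).
apply: mpoly_vanish_qnorm => q Nq.
transitivity (\sum_j C i j * 'X_[b j].@[q]).
  by rewrite raddf_sum; apply: eq_bigr => j _; rewrite /= mevalZ.
move: i; apply: (coefX (fun i => \sum_j C i j * 'X_[b j].@[q])).
apply: mpoly_vanish_qnorm => p Np.
rewrite -[RHS](C0 p q) ?mulf_neq0 // raddf_sum; apply: eq_bigr => i _ /=.
by rewrite mevalZ mulr_suml; apply: eq_bigr => j _; rewrite mulrAC mulrA.
Qed.

End QuaternionNorm.

(** * The ideal of the cone *)

Lemma scaled_lrquat_SO4 (F : fieldType) (p q : 'I_4 -> F) c
    (M := c^-1 *: (lquat p *m rquat q)) :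
  c ^+ 2 = qnorm p * qnorm q -> c != 0 -> M^T *m M = 1%:M /\ \det M = 1.
Proof.
move=> c2 c0; rewrite /M; split.
  rewrite [(_ *: _)^T]linearZ /= trmx_mul -scalemxAl -scalemxAr scalerA -mulmxA.
  rewrite (mulmxA (lquat p)^T) lquat_orth mul_scalar_mx -scalemxAr rquat_orth.
  rewrite !scale_scalar_mx -c2; congr (_%:M); field; exact: c0.
rewrite detZ det_mulmx det_lquat det_rquat -exprMn -c2; field; exact: c0.
Qed.

Section Cone.
Implicit Types (p q : 'I_4 -> CC) (f : Pol).

Lemma evalM_sum M n (c : 'I_n -> CC) (f : 'I_n -> Pol) :
  evalM (\sum_i c i *: f i) M = \sum_i c i * evalM (f i) M.
Proof.
by rewrite /evalM raddf_sum; apply: eq_bigr => i _; rewrite /= mevalZ.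
Qed.

(** With c a square root of N(p) N(q), the matrix L(p) R(q) is c times an element of SO(4). *)
Lemma I_cone_eval f p q : I_cone f -> qnorm p * qnorm q != 0 ->
  evalM f (lquat p *m rquat q) = 0.
Proof.
(* A set lies in its closure, so membership in [scaledSO4] suffices. *)
move=> If N0; apply: If => g; apply.
pose c : CC := sqrtC (qnorm p * qnorm q).
have c2 : c ^+ 2 = qnorm p * qnorm q by apply: sqrtCK.
have c0 : c != 0 by rewrite sqrtC_eq0.
exists c, (c^-1 *: (lquat p *m rquat q)); split; last first.
  by rewrite scalerA mulfV ?scale1r.
exact: scaled_lrquat_SO4 c2 c0.
Qed.

(** Vanishing on [scaledSO4] passes to the closure, and a scalar factor of L(p) R(q) is absorbed
    into p. *)
Lemma I_coneI f : (forall p q, evalM f (lquat p *m rquat q) = 0) -> I_cone f.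
Proof.
move=> f0 N; apply=> _ [c [M [[MtM detM] ->]]].
have [p [q ->]] := SO4_lrquat MtM detM.
suff -> : c *: (lquat p *m rquat q) = lquat (fun i => c * p i) *m rquat q by [].
rewrite scalemxAl; congr (_ *m _).
by apply/matrixP; elim/ord4_ind; elim/ord4_ind; rewrite !mxE /= ?mulrN.
Qed.

(** The entries of L(p) R(q) are bilinear in p and q, so a monomial of degree d in them has bidegree
    (d, d). *)
Lemma bihomog_evalM d f : f \is d.-homog ->
  bihomog d (fun p q => evalM f (lquat p *m rquat q)).
Proof.
move=> hf; pose X i := 'X_i : {mpoly CC[4]}.
have hX i : X i \is 1.-homog by rewrite dhomogX /= mdeg1.
have hl i k : lquat X i k \is 1.-homog.
  by move: i k; elim/ord4_ind; elim/ord4_ind; rewrite mxE /= ?rpredN; apply: hX.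
have hr k j : rquat X k j \is 1.-homog.
  by move: k j; elim/ord4_ind; elim/ord4_ind; rewrite mxE /= ?rpredN; apply: hX.
have lE i k p : lquat p i k = (lquat X i k).@[p].
  by move: i k; elim/ord4_ind; elim/ord4_ind; rewrite !mxE /= ?mevalN mevalXU.
have rE k j q : rquat q k j = (rquat X k j).@[q].
  by move: k j; elim/ord4_ind; elim/ord4_ind; rewrite !mxE /= ?mevalN mevalXU.
have h1 (k : 'I_(4 * 4)) :
    bihomog 1 (fun p q => mxvec (lquat p *m rquat q) 0 k).
  case/mxvec_indexP: k => i j.
  exists [seq (lquat X i k, rquat X k j) | k <- enum 'I_4]; split=> [A|p q].
    by case/mapP=> k _ -> /=; split; [apply: hl | apply: hr].
  rewrite mxvecE mxE big_map big_enum /=; apply: eq_bigr => k _.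
  by rewrite lE rE.
pose G m p q : CC := \prod_(k < 4 * 4) mxvec (lquat p *m rquat q) 0 k ^+ m k.
have hG (m : 'X_{1..4 * 4}) : m \in msupp f ->
    bihomog d (fun p q => f@_m * G m p q).
  move=> /(dhomog_mf hf) <-; apply: bihomogZ; rewrite /= mdegE.
  exact: (bihomog_prod _ _ h1).
exact: (bihomog_sum hG).
Qed.

(** The linear form on matrices whose value at L(p) R(q) is p_a q_b. *)
Definition lrcoord a b : Pol :=
  4^-1 *: qtransform (\matrix_(i, j) 'X_(mxvec_index i j)) a b.

Lemma lrcoord_homog a b : lrcoord a b \is 1.-homog.
Proof.
have hX i j : 'X_(mxvec_index i j) \is [in CC[4 * 4], 1.-homog].
  by rewrite dhomogX /= mdeg1.
apply: rpredZ; move: a b; elim/ord4_ind; elim/ord4_ind; rewrite !mxE /=;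
  by rewrite ?(rpredB, rpredD).
Qed.

Lemma evalM_lrcoord a b M : evalM (lrcoord a b) M = 4^-1 * qtransform M a b.
Proof.
rewrite /lrcoord /evalM mevalZ; congr (_ * _).
by move: a b; elim/ord4_ind; elim/ord4_ind;
  rewrite !mxE /= ?(mevalB, mevalD) ?mevalXU ?mxvecE.
Qed.

Lemma lrcoord_lrquat a b p q :
  evalM (lrcoord a b) (lquat p *m rquat q) = p a * q b.
Proof.
rewrite evalM_lrcoord lrquatE qtransformK mulmxnE mxE -(mulr_natl (_ * _)).
by rewrite mulKf ?pnatr_eq0.
Qed.

(** As the degrees agree, variables p_a and q_b can be peeled off in pairs, each pair being realized
    by [lrcoord a b]. *)
Lemma monomial_evalM d (m1 m2 : 'X_{1..4}) : mdeg m1 = d -> mdeg m2 = d ->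
  exists2 f : Pol, f \is d.-homog & forall p q,
    evalM f (lquat p *m rquat q) = 'X_[m1].@[p] * 'X_[m2].@[q].
Proof.
have peel (m : 'X_{1..4}) e : mdeg m = e.+1 ->
    exists a, exists2 m' : 'X_{1..4}, mdeg m' = e & m = (U_(a) + m')%MM.
  move=> me; have [a ma0] : exists a, m a != 0%N.
    apply/existsP; apply: contraT; rewrite negb_exists => /forallP m0.
    suff m00 : m = 0%MM by rewrite m00 mdeg0 in me.
    by apply/mnmP=> a; rewrite mnmE; apply/eqP; have := m0 a; rewrite negbK.
  have Um : (U_(a) <= m)%MM by rewrite lep1mP.
  have mE : m = (U_(a) + (m - U_(a)))%MM by rewrite addmC submK.
  exists a, (m - U_(a))%MM => //.
  by move: me; rewrite {1}mE mdegD mdeg1 => -[].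
elim: d m1 m2 => [|d IHd] m1 m2.
  move=> /eqP; rewrite mdeg_eq0 => /eqP -> /eqP; rewrite mdeg_eq0 => /eqP ->.
  exists 1; first exact: dhomog1.
  by move=> p q; rewrite /evalM mpolyX0 !meval1 mulr1.
move=> /peel[a [m1' h1 ->]] /peel[b [m2' h2 ->]].
have [f hf fE] := IHd _ _ h1 h2; exists (lrcoord a b * f).
  exact: dhomogM (lrcoord_homog a b) hf.
move=> p q; rewrite {1}/evalM mevalM -!/(evalM _ _) lrcoord_lrquat fE.
by rewrite !mpolyXD !mevalM !mevalXU mulrACA.
Qed.

(** Restriction to the matrices L(p) R(q) identifies the graded piece with the functions of bidegree
    (d, d), which have the products of two degree-d monomials as a basis. *)
Lemma dim_cone d : dim_graded_piece d ('C(d + 3, d) * 'C(d + 3, d)).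
Proof.
have [b b_inj b_cover] := monomial_basis 3 d.
set N := 'C(d + 3, d) in b b_inj b_cover *; split.
  have mdegb i : mdeg (b i) = d by apply/b_cover; exists i.
  have /fin_all_exists2[g hg gE] (ij : 'I_N * 'I_N) :=
    monomial_evalM (mdegb ij.1) (mdegb ij.2).
  pose f k := mxvec (\matrix_(i, j) g (i, j)) 0 k; exists f; split=> [k|c If].
    by case/mxvec_indexP: k => i j; rewrite /f mxvecE mxE.
  pose C := vec_mx (\row_k c k) : 'M[CC]_N.
  suff C0 : C = 0.
    move=> k; have := congr1 (fun A => mxvec A 0 k) C0.
    by rewrite /C vec_mxK mxE linear0 mxE.
  apply: (bihomog_coef_eq0 b_inj) => p q Npq.
  rewrite -[RHS](I_cone_eval If Npq) evalM_sum pair_big.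
  rewrite [RHS](reindex _ (curry_mxvec_bij _ _)) /=.
  apply: eq_bigr => -[i j] _ /=; rewrite /f mxvecE mxE gE /= /C.
  by rewrite !mxE.
move=> f [hf free_f].
have hC k : exists C : 'M[CC]_N, forall p q,
    evalM (f k) (lquat p *m rquat q) =
    \sum_i \sum_j C i j * ('X_[b i].@[p] * 'X_[b j].@[q]).
  exact: bihomog_coef b_inj b_cover (bihomog_evalM (hf k)).
have [C CE] := fin_all_exists hC.
pose A : 'M[CC]_((N * N).+1, N * N) := \matrix_k mxvec (C k).
(* One more row than columns forces a nontrivial linear relation u between the rows. *)
have /rowV0Pn[u uA u0] : kermx A != 0.
  rewrite kermx_eq0 /row_free neq_ltn (leq_ltn_trans (rank_leq_col _)) //.
have uA0 : u *m A = 0 by apply/sub_kermxP.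
have sumC0 : \sum_k u 0 k *: C k = 0.
  apply: (can_inj mxvecK); rewrite linear0 -uA0 raddf_sum.
  rewrite mulmx_sum_row; apply: eq_bigr => k _.
  by rewrite /= linearZ rowK.
case/eqP: u0; apply/rowP=> k; rewrite mxE; move: k.
apply: free_f; apply: I_coneI => p q; rewrite evalM_sum.
transitivity (\sum_i \sum_j (\sum_k u 0 k *: C k) i j
    * ('X_[b i].@[p] * 'X_[b j].@[q])).
  under eq_bigr => k _ do rewrite CE mulr_sumr.
  rewrite exchange_big /=; apply: eq_bigr => i _.
  under eq_bigr => k _ do rewrite mulr_sumr.
  rewrite exchange_big /=; apply: eq_bigr => j _.
  rewrite summxE [RHS]mulr_suml; apply: eq_bigr => k _.
  by rewrite mxE mulrA.
rewrite sumC0 big1 // => i _; rewrite big1 // => j _.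
by rewrite mxE mul0r.
Qed.

End Cone.

(** * The Hilbert series *)

(** The factor 6 clears the denominator of this cubic polynomial in n. *)
Lemma bin3E n :
  6 * ('C(n + 3, n))%:R = (n%:R + 1) * (n%:R + 2) * (n%:R + 3) :> int.
Proof.
have -> : 'C(n + 3, n) = 'C(n + 3, 3) by rewrite -bin_sub ?leq_addr // addKn.
have E : ('C(n + 3, 3) * 6 = n.+3 * (n.+2 * n.+1))%N.
  by rewrite -[6%N]/(3`!) bin_ffact addn3 !ffactnS ffactn0 muln1.
by have := congr1 (fun m => m%:R : int) E; rewrite !natrM mulrC => ->; ring.
Qed.

(** From d = 7 on, the sum is a seventh finite difference of a polynomial of degree 6, hence 0; the
    cases d < 7 are computed. *)
Lemma hilbert_segre33 :
  hilbert_series_is (fun d => 'C(d + 3, d) * 'C(d + 3, d))%N.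
Proof.
move=> d; have [lt7|/subnK dE] := ltnP d 7; first last.
  move: (d - 7)%N dE => e <-.
  rewrite big_mkcond /= !big_ord_recr big_ord0 /=.
  have -> : numer (e + 7) = 0 by rewrite !addnS.
  have le_e j : (j <= 7)%N -> (j <= e + 7)%N.
    by move/leq_trans; apply; apply: leq_addl.
  rewrite !le_e //.
  (* This is [bin3E] squared at n = e + 7 - k, with the truncated subtraction turned into one of
     integers. *)
  have sq k : (k <= 7)%N -> 36 * (('C(e + 7 - k + 3, e + 7 - k) *
      'C(e + 7 - k + 3, e + 7 - k))%N)%:R =
    ((e%:R + 8 - k%:R) * (e%:R + 9 - k%:R) * (e%:R + 10 - k%:R)) ^+ 2 :> int.
    move=> le7; have := bin3E (e + 7 - k); rewrite natrB ?le_e // natrM => E.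
    transitivity ((6 * ('C(e + 7 - k + 3, e + 7 - k))%:R : int) ^+ 2).
      by ring.
    by rewrite E natrD; ring.
  apply: (@mulfI int 36) => //; rewrite !mulrDr mulr0.
  rewrite !(mulrCA 36) !sq // bin0 binn; ring.
case: d lt7 => [|[|[|[|[|[|[|//]]]]]]] _;
  by rewrite big_mkcond /= !big_ord_recr big_ord0 /=; vm_compute.
Qed.

Theorem theorem4p4 :
  exists h : nat -> nat,
    (forall d : nat, dim_graded_piece d (h d)) /\ hilbert_series_is h.
Proof.
exists (fun d => 'C(d + 3, d) * 'C(d + 3, d))%N.
by split; [apply: dim_cone | apply: hilbert_segre33].
Qed.
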